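(* Let $m\ge 3$, let $\mathfrak g$ be the simple Lie algebra of type $D_m$, and let $n\ge1$. The action of the cactus group $C_{\mathfrak g}$ on the crystal $B(n\varpi_1)$ is generated by the elements corresponding to subdiagrams of length $1$ and $2$; that is, the image of $C_{\mathfrak g}$ in the group of permutations of $B(n\varpi_1)$ is generated by the images of the generators $c_J$ with $J\subseteq I$ a connected subdiagram having one or two nodes.
   Context: Setting. $I=\{1,\dots,m\}$ is the Dynkin diagram of type $D_m$ with spin nodes $m-1,m$ (both adjacent to $m-2$; $i$ is adjacent to $i+1$ for $i\le m-2$), $\alpha_i=\epsilon_i-\epsilon_{i+1}$ for $i\le m-1$, $\alpha_m=\epsilon_{m-1}+\epsilon_m$, $W=\langle s_i\rangle$ is the Weyl group. The crystal $B(n\varpi_1)$ is the set of rows $b_1b_2\cdots b_n$ of length $n$, weakly increasing in the poset $1<2<\dots<m-1<m,\overline m<\overline{m-1}<\dots<\overline 1$ in which $m$ and $\overline m$ are incomparable (so $m,\overline m$ never both appear). The weight is the sum of the weights of the entries, $\mathrm{wt}(i)=\epsilon_i$, $\mathrm{wt}(\overline i)=-\epsilon_i$. On single letters: $f_i(i)=i+1$, $f_i(\overline{i+1})=\overline i$ for $1\le i\le m-1$; $f_m(m-1)=\overline m$, $f_m(m)=\overline{m-1}$; all other $f_i$ of letters are $0$; $e_i(x)=y$ iff $f_i(y)=x$. On a row, for fixed $i$, write from left to right a $+$ for each letter $x$ with $f_i(x)\ne0$ and a $-$ for each letter with $e_i(x)\neq 0$, successively cancel pairs $-+$, leaving $+\cdots+-\cdots-$;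 $f_i$ applies $f_i$ to the letter of the rightmost uncancelled $+$ (result $0$ if none) and $e_i$ applies $e_i$ to the letter of the leftmost uncancelled $-$ (result $0$ if none). Cactus group. For connected $J\subseteq I$ let $w_{0,J}$ be the longest element of $W_J=\langle s_j: j\in J\rangle$ and $\theta_J:J\to J$ be given by $\alpha_{\theta_J(j)}=-w_{0,J}\alpha_j$. $C_{\mathfrak g}$ is the group with generators $c_J$ for each nonempty connected subdiagram $J\subseteq I$ and relations $c_J^2=1$; $c_Jc_K=c_Kc_J$ if $J\cup K$ is disconnected (i.e. $J,K$ are disjoint with no edge between them); $c_Jc_K=c_Kc_{\theta_K(J)}$ if $J\subseteq K$. It acts on $B(n\varpi_1)$ as follows: $c_J$ acts as the unique map preserving each connected component of the crystal restricted to $J$ (keep only edges labelled by $J$) and satisfying $\mathrm{wt}(c_J b)=w_{0,J}\mathrm{wt}(b)$, $e_j c_J(b)=c_J(f_{\theta_J(j)}b)$, $f_jc_J(b)=c_J(e_{\theta_J(j)}b)$ for $j\in J$ (with $c_J(0)=0$). *)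

(* Defs.v *)
From HB Require Import structures.
From mathcomp Require Import all_boot all_order all_algebra all_fingroup.
From mathcomp Require Import boolp.
From mathcomp Require classical_sets.

Set Implicit Arguments.
Unset Strict Implicit.
Unset Printing Implicit Defensive.

Import GRing.Theory.
Local Open Scope ring_scope.

(* Everything is 0-indexed: the node i : 'I_m stands for the node i.+1 of D_m,
   so the spin nodes are m.-2 and m.-1, both adjacent to m - 3.  These are the
   usual D_m data only when 3 <= m, which the theorem assumes. *)

Section TypeD.
Variable m : nat.

(** ** Root system and Weyl group *)

Definition weight := 'rV[int]_m.

Definition eps (k : nat) : weight := \row_(j < m) (j == k :> nat)%:R.

Definition simple_root (i : 'I_m) : weight :=
  if (i.+1 < m)%N then eps i - eps i.+1 else eps i.-1 + eps i.

Definition dot (v w : weight) : int := \sum_(j < m) v 0 j * w 0 j.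

(* All roots have squared length 2, so every root is its own coroot. *)
Definition reflection (i : 'I_m) (v : weight) : weight :=
  v - dot v (simple_root i) *: simple_root i.

(* The element s_{i_1} ... s_{i_k} of the Weyl group, as a map on weights. *)
Definition word_act (s : seq 'I_m) (v : weight) : weight :=
  foldr reflection v s.

(* [s] is a reduced expression in W_J: its size is the length of the element
   it represents. *)
Definition reduced (J : {set 'I_m}) (s : seq 'I_m) : Prop :=
  all [in J] s /\
  forall t, all [in J] t -> word_act t =1 word_act s -> (size s <= size t)%N.

Definition longest (J : {set 'I_m}) (s : seq 'I_m) : Prop :=
  reduced J s /\ forall t, reduced J t -> (size t <= size s)%N.

(* Different reduced expressions of the longest element of W_J give the same
   map; one of them is chosen. *)
Definition w0 (J : {set 'I_m}) : weight -> weight :=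
  word_act (classical_sets.xget [::] (longest J)).

Definition theta (J : {set 'I_m}) (j : 'I_m) : 'I_m :=
  odflt j [pick k in J | simple_root k == - w0 J (simple_root j)].

(** ** Dynkin diagram *)

Definition edge (i j : 'I_m) : bool :=
  ((j == i.+1 :> nat) && (j.+1 < m)%N) || ((i.+3 == m) && (j.+1 == m)).

Definition adjacent (i j : 'I_m) : bool := edge i j || edge j i.

Definition connected_sub (J : {set 'I_m}) : bool :=
  (J != set0) &&
  [forall i in J, forall j in J,
     connect [rel x y | [&& x \in J, y \in J & adjacent x y]] i j].

Definition apart (J K : {set 'I_m}) : bool :=
  [disjoint J & K] && [forall i in J, forall j in K, ~~ adjacent i j].

(** ** Cactus group *)

Definition subdiagram := {J : {set 'I_m} | connected_sub J}.

(* Since the generators are involutions, every element of the cactus group is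
   a product of generators, so the group is the quotient of the free monoid on
   the generators by the congruence spanned by the relations; the inverse of a
   word is its reversal. *)
Inductive cactus_rel : seq subdiagram -> seq subdiagram -> Prop :=
| Cactus_invol (J : subdiagram) : cactus_rel [:: J; J] [::]
| Cactus_comm (J K : subdiagram) : apart (val J) (val K) ->
    cactus_rel [:: J; K] [:: K; J]
| Cactus_nested (J K L : subdiagram) :
    val J \subset val K -> val L = [set theta (val K) j | j in val J] ->
    cactus_rel [:: J; K] [:: K; L]
| Cactus_refl s : cactus_rel s s
| Cactus_sym s t : cactus_rel s t -> cactus_rel t s
| Cactus_trans t s u : cactus_rel s t -> cactus_rel t u -> cactus_rel s u
| Cactus_cat s s' t t' :
    cactus_rel s s' -> cactus_rel t t' -> cactus_rel (s ++ t) (s' ++ t').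

Definition cactus_relb (s t : seq subdiagram) : bool := `[< cactus_rel s t >].

Lemma cactus_relb_refl : reflexive cactus_relb.
Proof. by move=> s; apply/asboolP; apply: Cactus_refl. Qed.

Lemma cactus_relb_sym : symmetric cactus_relb.
Proof.
by move=> s t; apply/idP/idP => /asboolP h; apply/asboolP; apply: Cactus_sym.
Qed.

Lemma cactus_relb_trans : transitive cactus_relb.
Proof.
move=> t s u /asboolP hst /asboolP htu; apply/asboolP.
exact: Cactus_trans hst htu.
Qed.

Canonical cactus_equiv :=
  EquivRel cactus_relb cactus_relb_refl cactus_relb_sym cactus_relb_trans.

Definition cactus : Type := {eq_quot cactus_equiv}%qT.
HB.instance Definition _ := Choice.on cactus.

Definition cactus_pi (s : seq subdiagram) : cactus :=
  (\pi_({eq_quot cactus_equiv}) s)%qT.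
Definition cactus_repr (g : cactus) : seq subdiagram :=
  generic_quotient.repr (g : {eq_quot cactus_equiv}%qT).

Lemma cactus_reprK g : cactus_pi (cactus_repr g) = g.
Proof. exact: reprK. Qed.

Lemma cactus_piP s t : cactus_pi s = cactus_pi t <-> cactus_rel s t.
Proof.
rewrite /cactus_pi; split => [/eqP|h].
  by rewrite eqmodE => /asboolP.
by apply/eqP; rewrite eqmodE; apply/asboolP.
Qed.

Lemma cactus_pi_repr s : cactus_rel (cactus_repr (cactus_pi s)) s.
Proof. by apply/cactus_piP; rewrite cactus_reprK. Qed.

Lemma cactus_rel_rev s t : cactus_rel s t -> cactus_rel (rev s) (rev t).
Proof.
elim=> {s t} [J|J K JK|J K L JK defL|s|s t _|t s u _ st _|s s' t t' _ hs _ ht].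
- exact: Cactus_invol.
- by apply: Cactus_sym; apply: Cactus_comm.
- (* c_K c_J = c_K c_J c_K c_K = c_K c_K c_L c_K = c_L c_K *)
  have hr := Cactus_refl; have hi := Cactus_invol.
  have h1 : cactus_rel [:: K; J; K; K] [:: K; J].
    exact: (Cactus_cat (hr [:: K; J]) (hi K)).
  have h2 : cactus_rel [:: K; J; K; K] [:: K; K; L; K].
    have hn := Cactus_nested JK defL.
    exact: (Cactus_cat (hr [:: K]) (Cactus_cat hn (hr [:: K]))).
  have h3 : cactus_rel [:: K; K; L; K] [:: L; K].
    exact: (Cactus_cat (hi K) (hr [:: L; K])).
  exact: Cactus_trans (Cactus_sym h1) (Cactus_trans h2 h3).
- exact: Cactus_refl.
- exact: Cactus_sym.
- exact: Cactus_trans.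
- by rewrite !rev_cat; apply: Cactus_cat.
Qed.

Lemma cactus_rel_revl s : cactus_rel (rev s ++ s) [::].
Proof.
elim: s => [|J s IHs]; first exact: Cactus_refl.
rewrite rev_cons -cats1 -catA /=; apply: Cactus_trans _ IHs.
exact: (Cactus_cat (Cactus_refl _) (Cactus_cat (Cactus_invol J) (Cactus_refl s))).
Qed.

Definition cactus_one : cactus := cactus_pi [::].
Definition cactus_mul (g h : cactus) : cactus :=
  cactus_pi (cactus_repr g ++ cactus_repr h).
Definition cactus_inv (g : cactus) : cactus := cactus_pi (rev (cactus_repr g)).

Lemma cactus_mulE s t :
  cactus_mul (cactus_pi s) (cactus_pi t) = cactus_pi (s ++ t).
Proof. by apply/cactus_piP; apply: Cactus_cat; apply: cactus_pi_repr. Qed.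

Lemma cactus_invE s : cactus_inv (cactus_pi s) = cactus_pi (rev s).
Proof. by apply/cactus_piP; apply/cactus_rel_rev/cactus_pi_repr. Qed.

Lemma cactus_mulA : associative cactus_mul.
Proof.
move=> g h k; rewrite -(cactus_reprK g) -(cactus_reprK h) -(cactus_reprK k).
by rewrite !cactus_mulE catA.
Qed.

Lemma cactus_mul1 : left_id cactus_one cactus_mul.
Proof. by move=> g; rewrite -(cactus_reprK g) cactus_mulE. Qed.

Lemma cactus_mulg1 : right_id cactus_one cactus_mul.
Proof. by move=> g; rewrite -(cactus_reprK g) cactus_mulE cats0. Qed.

Lemma cactus_mulV : left_inverse cactus_one cactus_inv cactus_mul.
Proof.
move=> g; rewrite -(cactus_reprK g) cactus_invE cactus_mulE.
by apply/cactus_piP/cactus_rel_revl.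
Qed.

Lemma cactus_mulgV : right_inverse cactus_one cactus_inv cactus_mul.
Proof.
move=> g; rewrite -(cactus_reprK g) cactus_invE cactus_mulE.
apply/cactus_piP; rewrite -{1}[cactus_repr g]revK; exact: cactus_rel_revl.
Qed.

HB.instance Definition _ := isGroup.Build cactus
  cactus_mulA cactus_mul1 cactus_mulg1 cactus_mulV cactus_mulgV.

Definition cactus_gen (J : subdiagram) : cactus := cactus_pi [:: J].

(** ** The crystal of rows *)

(* [inl i] is the letter i, [inr i] is the letter i-bar. *)
Definition letter := ('I_m + 'I_m)%type.

Definition letter_le (x y : letter) : bool :=
  match x, y with
  | inl i, inl j => (i <= j)%N
  | inl i, inr j => ~~ ((i.+1 == m) && (j.+1 == m))
  | inr _, inl _ => false
  | inr i, inr j => (j <= i)%N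
  end.

Definition letter_wt (x : letter) : weight :=
  match x with inl i => eps i | inr i => - eps i end.

(* [letter_arrow i x y] holds iff f_i(x) = y. *)
Definition letter_arrow (i : 'I_m) (x y : letter) : bool :=
  if (i.+1 < m)%N then
    match x, y with
    | inl a, inl b => (a == i) && (b == i.+1 :> nat)
    | inr a, inr b => (a == i.+1 :> nat) && (b == i)
    | _, _ => false
    end
  else
    match x, y with
    | inl a, inr b => ((a.+2 == m) && (b.+1 == m)) ||
                      ((a.+1 == m) && (b.+2 == m))
    | _, _ => false
    end.

Definition letter_f (i : 'I_m) (x : letter) : option letter :=
  [pick y | letter_arrow i x y].
Definition letter_e (i : 'I_m) (x : letter) : option letter :=
  [pick y | letter_f i y == Some x].

Section Rows.
Variable n : nat.

Definition row_type := {t : n.-tuple letter | sorted letter_le t}.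

Definition wt (b : row_type) : weight := \sum_(x <- val b) letter_wt x.

(* Pairs (position, sign), where true is + and false is -. *)
Definition signature (i : 'I_m) (t : n.-tuple letter) : seq ('I_n * bool) :=
  pmap (fun k => if letter_f i (tnth t k) then Some (k, true)
                 else if letter_e i (tnth t k) then Some (k, false)
                 else None) (enum 'I_n).

Definition cancel_cons (p : 'I_n * bool) (s : seq ('I_n * bool)) :=
  match p, s with
  | (_, false), (_, true) :: s' => s'
  | _, _ => p :: s
  end.

(* Cancels the adjacent pairs -+ from right to left, so that what remains at
   each step is of the form + ... + - ... - . *)
Definition reduced_signature (i : 'I_m) (t : n.-tuple letter) :=
  foldr cancel_cons [::] (signature i t).

Definition rightmost_plus (i : 'I_m) (t : n.-tuple letter) : option 'I_n :=
  ohead (rev [seq p.1 | p <- reduced_signature i t & p.2]).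
Definition leftmost_minus (i : 'I_m) (t : n.-tuple letter) : option 'I_n :=
  ohead [seq p.1 | p <- reduced_signature i t & ~~ p.2].

Definition set_letter (t : n.-tuple letter) (k : 'I_n) (y : letter) :
  n.-tuple letter := [tuple if l == k then y else tnth t l | l < n].

(* [None] plays the role of 0.  The set of rows is stable under these
   operators, so that [insub] only casts the modified word back to a row. *)
Definition crystal_f (i : 'I_m) (b : row_type) : option row_type :=
  obind (fun k => obind (fun y => insub (set_letter (val b) k y))
                        (letter_f i (tnth (val b) k)))
        (rightmost_plus i (val b)).
Definition crystal_e (i : 'I_m) (b : row_type) : option row_type :=
  obind (fun k => obind (fun y => insub (set_letter (val b) k y))
                        (letter_e i (tnth (val b) k)))
        (leftmost_minus i (val b)).

Definition same_component (J : {set 'I_m}) (b b' : row_type) : bool :=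
  connect [rel x y | [exists j in J, (crystal_f j x == Some y) ||
                                     (crystal_f j y == Some x)]] b b'.

(** ** The action of the cactus group *)

Definition cactus_map (J : {set 'I_m}) (c : row_type -> row_type) :=
  [/\ forall b, same_component J b (c b),
      forall b, wt (c b) = w0 J (wt b),
      forall j b, j \in J ->
        crystal_e j (c b) = omap c (crystal_f (theta J j) b)
    & forall j b, j \in J ->
        crystal_f j (c b) = omap c (crystal_e (theta J j) b)].

Definition cactus_action (act : cactus -> row_type -> row_type) : Prop :=
  [/\ forall b, act 1%g b = b,
      forall (g h : cactus) b, act (g * h)%g b = act g (act h b)
    & forall J : subdiagram, cactus_map (val J) (act (cactus_gen J))].

Definition in_image (act : cactus -> row_type -> row_type)
  (p : {perm row_type}) : Prop := exists g, p =1 act g.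

Definition small_generators (act : cactus -> row_type -> row_type) :
  {set {perm row_type}} :=
  [set p : {perm row_type} | [exists J : subdiagram,
     ((#|val J| == 1) || (#|val J| == 2))%N &&
     [forall b, p b == act (cactus_gen J) b]]].

End Rows.
End TypeD.

(* Main.v *)
(* A row is determined by its weight d and by the numbers M_l of pairs of a
   letter l with its bar, M_l = min(#l, #lbar), where M_m = 0.  For a node j
   whose simple root involves coordinates l and l+1 one has
     phi_j + epsilon_j = 2 M_l + |d_l| + |d_(l+1)|,
   and f_j changes no M_k with k <> l.  Since c_J exchanges phi_j and
   epsilon_theta(j), and w_(0,J) is a signed permutation of the coordinates
   taking alpha_theta(j) to - alpha_j, it follows that c_J acts on d by w_(0,J)
   and on M by the permutation of the columns 1, ..., m-1 that theta_J induces.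
   The c_J with one node realize the Weyl group on d and fix M; those with
   J = {i, i+1} realize moreover the transposition of M_i and M_(i+1). So all
   pairs of an element of W and a permutation of M_1, ..., M_(m-1) are products
   of small generators. *)

Require Import Defs.
From mathcomp Require Import all_boot all_order all_algebra all_fingroup.
From mathcomp Require Import boolp zify ring.
From mathcomp Require classical_sets.

Set Implicit Arguments.
Unset Strict Implicit.
Unset Printing Implicit Defensive.

Import GRing.Theory Num.Theory.

(** * Letters *)

Section Letters.
Variable m' : nat.
Local Notation m := m'.+3.
Implicit Types (i : 'I_m) (x y z : letter m).

(* The simple root of the node i is eps (lcol i) - eps (rcol i), with the sign
   of the last term reversed at the last node. *)
Definition lcol i : 'I_m := if i == ord_max then inord m'.+1 else i.
Definition rcol i : 'I_m := if i == ord_max then ord_max else inord i.+1.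

(* At every node f_i is a -> b, b' -> a'.  At the last node b is barred and b'
   is not; these two letters never occur together, so a row still reads
   a .. b .. b' .. a' there. *)
Definition letter_a i : letter m := inl (lcol i).
Definition letter_b i : letter m :=
  if i == ord_max then inr ord_max else inl (rcol i).
Definition letter_b' i : letter m :=
  if i == ord_max then inl ord_max else inr (rcol i).
Definition letter_a' i : letter m := inr (lcol i).

Lemma val_lcol i : lcol i = (if i == m'.+2 :> nat then m'.+1 else i) :> nat.
Proof.
rewrite /lcol -val_eqE /=; case: ifP => // _.
by rewrite inordK //; lia.
Qed.

Lemma val_rcol i : rcol i = (if i == m'.+2 :> nat then m'.+2 else i.+1) :> nat.
Proof.
rewrite /rcol -val_eqE /=; case: ifP => // h.
by rewrite inordK //; have := ltn_ord i; lia.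
Qed.

Definition lettersE := (val_lcol, val_rcol).

Lemma eq_ord (i j : 'I_m) : (i == j) = (i == j :> nat).
Proof. by []. Qed.

Lemma eq_inl (i j : 'I_m) : (inl i == inl j :> letter m) = (i == j :> nat).
Proof. by []. Qed.

Lemma eq_inr (i j : 'I_m) : (inr i == inr j :> letter m) = (i == j :> nat).
Proof. by []. Qed.

Lemma eq_inlr (i j : 'I_m) : (inl i == inr j :> letter m) = false.
Proof. by []. Qed.

Lemma eq_inrl (i j : 'I_m) : (inr i == inl j :> letter m) = false.
Proof. by []. Qed.

End Letters.

(** Once the last node is separated, every equality or comparison among the four letters of a node
    is linear arithmetic on indices. *)
Ltac letter_cases m' i :=
  have := ltn_ord i;
  rewrite /letter_a /letter_b /letter_b' /letter_a' /= ?inE ?eq_ord /=;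
  let h := fresh "h" in case: (eqVneq (i : nat) m'.+2) => h;
  rewrite ?(eq_inl, eq_inr, eq_inlr, eq_inrl) /=
    ?eq_ord ?lettersE ?h ?(negPf h) ?eqxx ?ltnn /=.

(** * The four letters of a node in the order of letters *)

Section LetterOrder.
Variable m' : nat.
Local Notation m := m'.+3.
Implicit Types (i : 'I_m) (x y z : letter m).

Lemma letter_arrowE i x y : letter_arrow i x y =
  ((x == letter_a i) && (y == letter_b i)) ||
  ((x == letter_b' i) && (y == letter_a' i)).
Proof.
rewrite /letter_arrow.
case: x y => [x|x] [y|y]; have := ltn_ord x; have := ltn_ord y;
  letter_cases m' i; try case: (ltnP i.+1 m) => ?; lia.
Qed.

Lemma letter_neq i : uniq [:: letter_a i; letter_b i; letter_b' i; letter_a' i].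
Proof. by letter_cases m' i; lia. Qed.

Lemma letter_fE i x : letter_f i x =
  if x == letter_a i then Some (letter_b i)
  else if x == letter_b' i then Some (letter_a' i) else None.
Proof.
have /= := letter_neq i; rewrite !inE => /and4P[/norP[_ /norP[nab' _]] _ _ _].
rewrite /letter_f; case: pickP => [y|N].
  rewrite letter_arrowE => /orP[/andP[/eqP-> /eqP->]|/andP[/eqP-> /eqP->]].
    by rewrite eqxx.
  by rewrite eqxx eq_sym (negPf nab').
case: eqP => [xa|_]; first by have := N (letter_b i); rewrite letter_arrowE xa !eqxx.
by case: eqP => // xb; have := N (letter_a' i); rewrite letter_arrowE xb !eqxx orbT.
Qed.

Lemma letter_eE i x : letter_e i x =
  if x == letter_b i then Some (letter_a i)
  else if x == letter_a' i then Some (letter_b' i) else None.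
Proof.
have /= := letter_neq i; rewrite !inE.
move=> /and4P[/norP[_ /norP[nab' _]] /norP[_ nba'] _ _].
have fE y : (letter_f i y == Some x) = letter_arrow i y x.
  rewrite letter_fE letter_arrowE; case: (y =P letter_a i) => [->|_] /=.
    by rewrite (negPf nab') orbF eq_sym.
  by case: (y =P letter_b' i) => //= _; rewrite eq_sym.
rewrite /letter_e; case: pickP => [y|N].
  rewrite fE letter_arrowE => /orP[/andP[/eqP-> /eqP->]|/andP[/eqP-> /eqP->]].
    by rewrite eqxx.
  by rewrite eqxx eq_sym (negPf nba').
case: eqP => [xa|_]; first by have := N (letter_a i); rewrite fE letter_arrowE xa !eqxx.
by case: eqP => // xb; have := N (letter_b' i); rewrite fE letter_arrowE xb !eqxx orbT.
Qed.

Lemma letter_le_trans : transitive (@letter_le m).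
Proof.
by case=> y [] x [] z //=; have := ltn_ord x; have := ltn_ord y;
  have := ltn_ord z; lia.
Qed.

Lemma letter_le_anti : antisymmetric (@letter_le m).
Proof.
by case=> x [] y /=; rewrite ?andbF // => h; [congr inl|congr inr];
  apply: val_inj => /=; lia.
Qed.

Lemma letter_order i :
  [/\ letter_le (letter_a i) (letter_b i), letter_le (letter_b' i) (letter_a' i)
    & letter_le (letter_a i) (letter_a' i)].
Proof. by split; letter_cases m' i; lia. Qed.

Lemma letter_nle i :
  [/\ ~~ letter_le (letter_b i) (letter_a i),
      ~~ letter_le (letter_b' i) (letter_a i),
      ~~ letter_le (letter_a' i) (letter_a i),
      ~~ letter_le (letter_b' i) (letter_b i) &
      ~~ letter_le (letter_a' i) (letter_b i) /\
      ~~ letter_le (letter_a' i) (letter_b' i)].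
Proof. by do ?split; letter_cases m' i; lia. Qed.

(** With the next three lemmas, this keeps a row weakly increasing when one of its letters is
    replaced. The letter [letter_b' i] is excluded because at the two spin nodes it is incomparable
    with [letter_b i], and both lie just above [letter_a i]. *)
Lemma letter_cover_a i z : letter_le (letter_a i) z -> z != letter_a i ->
  z != letter_b' i -> letter_le (letter_b i) z.
Proof. by case: z => z; have := ltn_ord z; letter_cases m' i; lia. Qed.

Lemma letter_cover_b' i z : letter_le (letter_b' i) z -> z != letter_b' i ->
  letter_le (letter_a' i) z.
Proof. by case: z => z; have := ltn_ord z; letter_cases m' i; lia. Qed.

Lemma letter_cover_b i z : letter_le z (letter_b i) -> z != letter_b i ->
  letter_le z (letter_a i).
Proof. by case: z => z; have := ltn_ord z; letter_cases m' i; lia. Qed.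

Lemma letter_cover_a' i z : letter_le z (letter_a' i) -> z != letter_a' i ->
  z != letter_b i -> letter_le z (letter_b' i).
Proof. by case: z => z; have := ltn_ord z; letter_cases m' i; lia. Qed.

End LetterOrder.

(** * Signatures *)

Section Signature.

(** Three applications cut a signature into its blocks: each time [P] selects one letter, which
    stands before all others that are left. *)
Lemma sorted_split (T : eqType) (R : rel T) (P : pred T) (s : seq T) :
  transitive R -> sorted R s -> {in s &, forall x y, R x y -> P y -> P x} ->
  s = filter P s ++ filter (predC P) s.
Proof.
move=> trR; elim: s => // x s IHs /= srt hP.
have srt' := path_sorted srt.
have hP' : {in s &, forall x y, R x y -> P y -> P x}.
  by move=> y z ys zs; apply: hP; rewrite inE (ys, zs) orbT.
case: ifPn => Px /=; first by rewrite {1}(IHs srt' hP').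
have nP : all (predC P) s.
  apply/allP => y ys /=; apply: contra Px; apply: hP (mem_head _ _) _ _.
    by rewrite inE ys orbT.
  by move/(order_path_min trR)/allP: srt; apply.
rewrite (eq_in_filter (a2 := pred0)) ?filter_pred0 /=; first by rewrite (all_filterP nP).
by move=> y /(allP nP) /negPf.
Qed.

Definition plus (T : Type) (s : seq T) := [seq (k, true) | k <- s].
Definition minus (T : Type) (s : seq T) := [seq (k, false) | k <- s].

Variable n : nat.
Implicit Types A B C D : seq 'I_n.

Lemma foldr_cancel_plus A s : foldr (@cancel_cons n) s (plus A) = plus A ++ s.
Proof. by elim: A => //= k A ->. Qed.

Lemma foldr_cancel_minus D : foldr (@cancel_cons n) [::] (minus D) = minus D.
Proof. by elim: D => //= k [|l D] -> //. Qed.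

(** Matching goes inwards out: the last minuses of [B] cancel the first pluses of [C]. Of the pieces
    [take] and [drop], at least one is empty. *)
Lemma foldr_cancel_minus_plus B C D :
  foldr (@cancel_cons n) (plus C ++ minus D) (minus B) =
  minus (take (size B - size C) B) ++ plus (drop (size B) C) ++ minus D.
Proof.
elim: B D => [|k B IHB] D; first by rewrite /= drop0.
(* The new minus cancels the first surviving plus if there is one; otherwise it joins the
   minuses. *)
rewrite [LHS]/= IHB /=; case: (ltnP (size B) (size C)) => h.
  have /eqP -> : size B - size C == 0 by lia.
  have /eqP -> : (size B).+1 - size C == 0 by lia.
  by rewrite !take0 /= (drop_nth k h).
rewrite !drop_oversize ?subSn //=; last exact: leqW.
by case: (take _ B) D {IHB} => [[|l D]|l s D].
Qed.

Variable m' : nat.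
Local Notation m := m'.+3.
Implicit Types (i : 'I_m) (x y z : letter m) (t : n.-tuple (letter m)).

Definition positions x t : seq 'I_n := [seq k <- enum 'I_n | tnth t k == x].

Lemma size_positions x t : size (positions x t) = count_mem x t.
Proof.
by rewrite size_filter -[in RHS](map_tnth_enum t) [RHS]count_map.
Qed.

Lemma mem_positions x t k : (k \in positions x t) = (tnth t k == x).
Proof. by rewrite mem_filter mem_enum andbT. Qed.

Lemma pairwise_positions x t : pairwise (fun k l : 'I_n => k < l) (positions x t).
Proof.
rewrite pairwise_filter // -sorted_pairwise; last by move=> ? ? ?; apply: ltn_trans.
have := iota_ltn_sorted 0 n; rewrite -val_enum_ord sorted_map.
exact: sub_sorted.
Qed.

Lemma sorted_tnth t : sorted (@letter_le m) t <->
  forall k l : 'I_n, k < l -> letter_le (tnth t k) (tnth t l).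
Proof.
split=> [srt k l kl|h].
  have x0 := tnth t k.
  rewrite !(tnth_nth x0).
  by apply: (sorted_ltn_nth (@letter_le_trans m')); rewrite ?inE ?size_tuple.
case: n t h => [|n'] t h; first by rewrite (tuple0 t).
have x0 := tnth t ord0.
apply/(sortedP x0) => k; rewrite size_tuple => kn.
have := h (Ordinal (ltnW kn)) (Ordinal kn) (ltnSn k).
by rewrite !(tnth_nth x0).
Qed.

(** By [letter_nle], none of a, b, b', a' can follow a later member of this list in a row, so the
    signs come in four blocks. At a spin node one of the two middle blocks is empty. *)
Lemma signatureE i t : sorted (@letter_le m) t ->
  signature i t =
    plus (positions (letter_a i) t) ++ minus (positions (letter_b i) t) ++
    plus (positions (letter_b' i) t) ++ minus (positions (letter_a' i) t).
Proof.
move=> srt.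
have := letter_neq i; rewrite /= !inE => /and4P[/norP[nab /norP[nab' naa']]].
move=> /norP[nbb' nba'] nb'a' _.
case: (letter_nle i) => lba lb'a la'a lb'b [la'b la'b'].
pose R (k l : 'I_n) := letter_le (tnth t k) (tnth t l).
have trR : transitive R by move=> ? ? ?; apply: letter_le_trans.
pose f (k : 'I_n) := if letter_f i (tnth t k) then Some (k, true)
  else if letter_e i (tnth t k) then Some (k, false) else None.
pose four (k : 'I_n) := tnth t k
  \in [:: letter_a i; letter_b i; letter_b' i; letter_a' i].
(* Letters without a sign are dropped first; among the remaining four, [letter_nle] decides which
   may come later. *)
have -> : signature i t = pmap f (filter four (enum 'I_n)).
  rewrite /signature; elim: (enum 'I_n) => //= k s ->.
  rewrite -/(f k); case: ifPn => //; rewrite /four !inE !negb_or.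
  case/and4P=> /negPf h1 /negPf h2 /negPf h3 /negPf h4.
  by rewrite /f letter_fE letter_eE h1 h2 h3 h4.
have posE (P : pred 'I_n) x :
    (forall k, P k = (tnth t k == x)) -> filter P (enum 'I_n) = positions x t.
  by move=> h; apply: eq_filter.
pose S := filter four (enum 'I_n).
pose Pa k := tnth t k == letter_a i; pose Pb k := tnth t k == letter_b i.
pose Pb' k := tnth t k == letter_b' i.
have srtS : sorted R S.
  apply: (sorted_filter trR).
  by have := srt; rewrite -{1}(map_tnth_enum t) sorted_map.
have srtS1 := sorted_filter trR (predC Pa) srtS.
have srtS2 := sorted_filter trR (predC Pb) srtS1.
have /(sorted_split trR srtS) E1 : {in S &, forall k l, R k l -> Pa l -> Pa k}.
  move=> k l; rewrite !mem_filter /four !inE => /andP[/or4P[]/eqP kE _] _;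
    rewrite /R /Pa => + /eqP lE; rewrite lE kE ?eqxx //.
  - by rewrite (negPf lba).
  - by rewrite (negPf lb'a).
have /(sorted_split trR srtS1) E2 :
    {in filter (predC Pa) S &, forall k l, R k l -> Pb l -> Pb k}.
  move=> k l; rewrite !mem_filter /four !inE /= /Pa => /and3P[ka /or4P[]/eqP kE _] _;
    rewrite /R /Pb => + /eqP lE; rewrite lE kE ?eqxx //.
  - by rewrite kE eqxx in ka.
  - by rewrite (negPf lb'b).
  - by rewrite (negPf la'b).
have /(sorted_split trR srtS2) E3 : {in filter (predC Pb) (filter (predC Pa) S) &,
    forall k l, R k l -> Pb' l -> Pb' k}.
  move=> k l; rewrite !mem_filter /four !inE /= /Pa /Pb.
  move=> /and4P[kb ka /or4P[]/eqP kE _] _;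
    rewrite /R /Pb' => + /eqP lE; rewrite lE kE ?eqxx //.
  - by rewrite kE eqxx in ka.
  - by rewrite kE eqxx in kb.
  - by rewrite (negPf la'b').
rewrite -/S E1 E2 E3 /S -!(filter_predI _ _ (enum _)) (posE _ (letter_a i)); last first.
  by move=> k /=; rewrite /Pa /four !inE; case: eqP.
rewrite (posE _ (letter_b i)); last first.
  move=> k /=; rewrite /Pa /Pb /four !inE.
  case: (tnth t k =P letter_b i) => //= ->.
  by rewrite [letter_b i == letter_a i]eq_sym nab ?eqxx ?orbT.
rewrite (posE _ (letter_b' i)); last first.
  move=> k /=; rewrite /Pa /Pb /Pb' /four !inE.
  case: (tnth t k =P letter_b' i) => //= ->.
  by rewrite ![letter_b' i == letter_a i]eq_sym ![_ == letter_b i]eq_sym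
    nbb' nab' ?eqxx ?orbT.
rewrite (posE _ (letter_a' i)); last first.
  move=> k /=; rewrite /Pa /Pb /Pb' /four !inE.
  case: (tnth t k =P letter_a' i) => [->|].
    by rewrite ![letter_a' i == _]eq_sym naa' nba' nb'a' ?eqxx ?orbT.
  by case: (_ == letter_a i); case: (_ == letter_b i); case: (_ == letter_b' i).
have pmapE x o : (forall k, tnth t k == x -> f k = Some (k, o)) ->
    pmap f (positions x t) = [seq (k, o) | k <- positions x t].
  move=> h; have : {in positions x t, forall k, f k = Some (k, o)}.
    by move=> k; rewrite mem_positions; apply: h.
  elim: (positions x t) => //= k s IHs hs; rewrite hs ?mem_head //= IHs //.
  by move=> l ls; apply: hs; rewrite inE ls orbT.
rewrite !pmap_cat (pmapE (letter_a i) true) ?(pmapE (letter_b i) false)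
  ?(pmapE (letter_b' i) true) ?(pmapE (letter_a' i) false) //;
  move=> k /eqP kE; rewrite /f letter_fE letter_eE kE ?eqxx //.
- by rewrite ![letter_a' i == _]eq_sym (negPf naa') (negPf nb'a') (negPf nba').
- by case: (_ == letter_a i).
- by rewrite eq_sym (negPf nab) (negPf nbb').
Qed.

(** The pluses from a lie left of everything and the minuses from a' right of everything, so only b
    and b' cancel. *)
Lemma reduced_signatureE i t : sorted (@letter_le m) t ->
  let B := positions (letter_b i) t in let C := positions (letter_b' i) t in
  reduced_signature i t =
    plus (positions (letter_a i) t ++ drop (size B) C) ++
    minus (take (size B - size C) B ++ positions (letter_a' i) t).
Proof.
move=> srt B C; rewrite /reduced_signature (signatureE _ srt) !foldr_cat -/B -/C.
rewrite foldr_cancel_minus !foldr_cancel_plus foldr_cancel_minus_plus.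
rewrite /plus /minus !map_cat -!catA; congr cat.
case: (leqP (size C) (size B)) => h; first by rewrite drop_oversize.
by have /eqP -> : size B - size C == 0; [lia | rewrite take0].
Qed.

Lemma rightmost_plusE i t : sorted (@letter_le m) t ->
  let B := positions (letter_b i) t in let C := positions (letter_b' i) t in
  rightmost_plus i t =
    ohead (rev (positions (letter_a i) t ++ drop (size B) C)).
Proof.
move=> srt B C; rewrite /rightmost_plus (reduced_signatureE _ srt) -/B -/C.
congr (ohead (rev _)); rewrite filter_cat map_cat /plus /minus.
rewrite !filter_map (eq_filter (a2 := predT)) // filter_predT.
by rewrite (eq_filter (a2 := pred0)) // filter_pred0 cats0 -map_comp map_id.
Qed.

Lemma leftmost_minusE i t : sorted (@letter_le m) t ->
  let B := positions (letter_b i) t in let C := positions (letter_b' i) t in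
  leftmost_minus i t =
    ohead (take (size B - size C) B ++ positions (letter_a' i) t).
Proof.
move=> srt B C; rewrite /leftmost_minus (reduced_signatureE _ srt) -/B -/C.
congr ohead; rewrite filter_cat map_cat /plus /minus.
rewrite !filter_map (eq_filter (a2 := pred0)) // filter_pred0.
by rewrite (eq_filter (a2 := predT)) // filter_predT cat0s -map_comp map_id.
Qed.

(** Surviving pluses from b' lie to the right of those from a, hence take precedence. That [k] is
    the last position of its letter is what keeps the row sorted under [crystal_f]. *)
Lemma rightmost_plusP i t : sorted (@letter_le m) t ->
  if count_mem (letter_b i) t < count_mem (letter_b' i) t then
    exists k, [/\ rightmost_plus i t = Some k, tnth t k = letter_b' i
      & forall l, tnth t l = letter_b' i -> l <= k]
  else if 0 < count_mem (letter_a i) t then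
    exists k, [/\ rightmost_plus i t = Some k, tnth t k = letter_a i
      & forall l, tnth t l = letter_a i -> l <= k]
  else rightmost_plus i t = None.
Proof.
move=> srt; rewrite (rightmost_plusE _ srt) -!size_positions.
have lastE x s k : positions x t = rcons s k ->
    tnth t k = x /\ forall l, tnth t l = x -> l <= k.
  move=> e; split; first by apply/eqP; rewrite -mem_positions e mem_rcons mem_head.
  move=> l /eqP; rewrite -mem_positions e mem_rcons inE.
  case/orP=> [/eqP->//|ls].
  have := pairwise_positions x t; rewrite e pairwise_rcons.
  by case/andP => /allP/(_ _ ls)/ltnW.
case: ltnP => h.
  case/lastP E: (positions (letter_b' i) t) h => [|s k] // h.
  have [tk kmax] := lastE _ _ _ E; exists k; split=> //.
  by rewrite size_rcons in h; rewrite drop_rcons // -rcons_cat rev_rcons.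
rewrite drop_oversize // cats0.
case/lastP E: (positions (letter_a i) t) => [|s k] //=.
rewrite size_rcons; have [tk kmax] := lastE _ _ _ E; exists k; split=> //.
by rewrite rev_rcons.
Qed.

Lemma leftmost_minusP i t : sorted (@letter_le m) t ->
  if count_mem (letter_b' i) t < count_mem (letter_b i) t then
    exists k, [/\ leftmost_minus i t = Some k, tnth t k = letter_b i
      & forall l, tnth t l = letter_b i -> k <= l]
  else if 0 < count_mem (letter_a' i) t then
    exists k, [/\ leftmost_minus i t = Some k, tnth t k = letter_a' i
      & forall l, tnth t l = letter_a' i -> k <= l]
  else leftmost_minus i t = None.
Proof.
move=> srt; rewrite (leftmost_minusE _ srt) -!size_positions.
have headE x s k : positions x t = k :: s ->
    tnth t k = x /\ forall l, tnth t l = x -> k <= l.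
  move=> e; split; first by apply/eqP; rewrite -mem_positions e mem_head.
  move=> l /eqP; rewrite -mem_positions e inE.
  case/orP=> [/eqP->//|ls].
  have := pairwise_positions x t; rewrite e pairwise_cons.
  by case/andP => /allP/(_ _ ls)/ltnW.
case: ltnP => h.
  case E: (positions (letter_b i) t) h => [|k s] // h.
  have [tk kmin] := headE _ _ _ E; exists k; split=> //.
  by rewrite subSn.
have /eqP -> : size (positions (letter_b i) t) - size (positions (letter_b' i) t) == 0.
  by lia.
rewrite take0 cat0s; case E: (positions (letter_a' i) t) => [|k s] //=.
by have [tk kmin] := headE _ _ _ E; exists k.
Qed.

Lemma sorted_set_letter t (k : 'I_n) y : sorted (@letter_le m) t ->
  (forall l : 'I_n, l < k -> letter_le (tnth t l) y) ->
  (forall l : 'I_n, k < l -> letter_le y (tnth t l)) ->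
  sorted (@letter_le m) (set_letter t k y).
Proof.
move=> /sorted_tnth srt lty ylt; apply/sorted_tnth => l l' ll'.
rewrite !tnth_mktuple; case: (l =P k) => [e|_].
  by rewrite ifN; [apply: ylt; rewrite -e | rewrite -e -val_eqE neq_ltn ll' orbT].
by case: (l' =P k) => [e|_]; [apply: lty; rewrite -e | apply: srt].
Qed.

(** A summand on each side avoids truncated subtraction; the crystal operators below are described
    in the same form. *)
Lemma count_set_letter t (k : 'I_n) x y :
  count_mem x (set_letter t k y) + (tnth t k == x) = count_mem x t + (y == x).
Proof.
have cE (u : n.-tuple (letter m)) : count_mem x u = \sum_l (tnth u l == x).
  rewrite -{1}(map_tnth_enum u) [LHS]count_map -sum1_count big_mkcond big_enum /=.
  by apply: eq_bigr => l _; case: eqP.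
rewrite !cE (bigD1 k) //= [in RHS](bigD1 k) //= tnth_mktuple eqxx.
have -> : \sum_(l | l != k) (tnth (set_letter t k y) l == x) =
          \sum_(l | l != k) (tnth t l == x).
  by apply: eq_bigr => l /negPf lk; rewrite tnth_mktuple lk.
move: (\sum_(l | l != k) _) => S; by case: (y == x); case: (tnth t k == x); lia.
Qed.

(** * Crystal operators in terms of letter counts *)

Implicit Types b : row_type m n.

Definition cnt x b := count_mem x (val b).

(** Meant for [letter_b] and [letter_b'], which are incomparable at a spin node and so cannot share
    a row there. *)
Lemma row_comparable b x y : 0 < cnt x b -> 0 < cnt y b ->
  letter_le x y || letter_le y x.
Proof.
rewrite -!has_count => /hasP[_ /tnthP[k ->] /eqP kx] /hasP[_ /tnthP[l ->] /eqP ly].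
have /sorted_tnth srt := valP b; rewrite -{}kx -{}ly.
case: (ltngtP k l) => [/srt->|/srt->|/val_inj->] //; first by rewrite orbT.
by case: (tnth _ _) => j /=; rewrite leqnn.
Qed.

Lemma cnt_set_letter b b2 (k : 'I_n) y : val b2 = set_letter (val b) k y ->
  forall x, cnt x b2 + (tnth (val b) k == x) = cnt x b + (y == x).
Proof. by move=> e x; rewrite /cnt e count_set_letter. Qed.

(** The cast [insub] succeeds because the replaced letter is the last of its kind and the cover
    lemmas apply. Only counts are recorded: they determine a sorted row, so the position can be
    forgotten. *)
Lemma crystal_fP i b :
  if cnt (letter_b i) b < cnt (letter_b' i) b then
    exists2 b2, crystal_f i b = Some b2 & forall x,
      cnt x b2 + (letter_b' i == x) = cnt x b + (letter_a' i == x)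
  else if 0 < cnt (letter_a i) b then
    exists2 b2, crystal_f i b = Some b2 & forall x,
      cnt x b2 + (letter_a i == x) = cnt x b + (letter_b i == x)
  else crystal_f i b = None.
Proof.
have := letter_neq i; rewrite /= !inE => /and4P[/norP[_ /norP[nab' _]] _ _ _].
have [ab b'a' _] := letter_order i.
have srt := valP b; have /sorted_tnth st := srt.
have := rightmost_plusP i srt; rewrite -!/(cnt _ _) /crystal_f.
case: ltnP => h1; last case: (posnP (cnt _ _)) => h2.
- move=> [k [-> tk kmax]] /=; rewrite tk letter_fE eq_sym (negPf nab') eqxx /=.
  case: insubP => [b2 _ e|/negP[]].
    by exists b2 => // x; rewrite -(cnt_set_letter e) tk.
  apply: sorted_set_letter => // l lk.
    by apply: letter_le_trans b'a'; rewrite -tk st.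
  apply: letter_cover_b'; first by rewrite -tk st.
  by apply/eqP => /kmax; lia.
- by move=> ->.
- move=> [k [-> tk kmax]] /=; rewrite tk letter_fE eqxx /=.
  case: insubP => [b2 _ e|/negP[]].
    by exists b2 => // x; rewrite -(cnt_set_letter e) tk.
  apply: sorted_set_letter => // l lk.
    by apply: letter_le_trans ab; rewrite -tk st.
  (* A later entry b' escapes [letter_cover_a]. In that case [h1] supplies a b in the row as well,
     and the two can only be comparable with b below b'. *)
  case: (tnth (val b) l =P letter_b' i) => [e|/eqP ne].
    have pb' : 0 < cnt (letter_b' i) b.
      by rewrite -has_count; apply/hasP; exists (letter_b' i) => //=; rewrite -e mem_tnth.
    rewrite e; case/orP: (row_comparable (leq_trans pb' h1) pb') => // c.
    by have [_ _ _ /negP[]] := letter_nle i.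
  apply: letter_cover_a ne; first by rewrite -tk st.
  by apply/eqP => /kmax; lia.
Qed.

Lemma crystal_eP i b :
  if cnt (letter_b' i) b < cnt (letter_b i) b then
    exists2 b2, crystal_e i b = Some b2 & forall x,
      cnt x b2 + (letter_b i == x) = cnt x b + (letter_a i == x)
  else if 0 < cnt (letter_a' i) b then
    exists2 b2, crystal_e i b = Some b2 & forall x,
      cnt x b2 + (letter_a' i == x) = cnt x b + (letter_b' i == x)
  else crystal_e i b = None.
Proof.
have := letter_neq i; rewrite /= !inE => /and4P[_ /norP[_ nba'] _ _].
have [ab b'a' _] := letter_order i.
have srt := valP b; have /sorted_tnth st := srt.
have := leftmost_minusP i srt; rewrite -!/(cnt _ _) /crystal_e.
case: ltnP => h1; last case: (posnP (cnt _ _)) => h2.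
- move=> [k [-> tk kmin]] /=; rewrite tk letter_eE eqxx /=.
  case: insubP => [b2 _ e|/negP[]].
    by exists b2 => // x; rewrite -(cnt_set_letter e) tk.
  apply: sorted_set_letter => // l lk.
    apply: letter_cover_b; first by rewrite -tk st.
    by apply/eqP => /kmin; lia.
  by apply: letter_le_trans ab _; rewrite -tk st.
- by move=> ->.
- move=> [k [-> tk kmin]] /=; rewrite tk letter_eE eq_sym (negPf nba') eqxx /=.
  case: insubP => [b2 _ e|/negP[]].
    by exists b2 => // x; rewrite -(cnt_set_letter e) tk.
  apply: sorted_set_letter => // l lk.
    case: (tnth (val b) l =P letter_b i) => [e|/eqP ne].
      have pb : 0 < cnt (letter_b i) b.
        by rewrite -has_count; apply/hasP; exists (letter_b i) => //=; rewrite -e mem_tnth.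
      rewrite e; case/orP: (row_comparable pb (leq_trans pb h1)) => // c.
      by have [_ _ _ /negP[]] := letter_nle i.
    apply: letter_cover_a' ne; first by rewrite -tk st.
    by apply/eqP => /kmin; lia.
  by apply: letter_le_trans b'a' _; rewrite -tk st.
Qed.

End Signature.

(** * Coordinates on rows *)

Section Coordinates.
Variables m' n : nat.
Local Notation m := m'.+3.
Implicit Types (i j : 'I_m) (x y : letter m) (b : row_type m n).

Definition paired b j := minn (cnt (inl j) b) (cnt (inr j) b).
(** Number of uncancelled pluses, and for [epsilon] of uncancelled minuses; truncated subtraction
    gives 0 when the middle block cancels completely. *)
Definition phi i b := cnt (letter_a i) b + (cnt (letter_b' i) b - cnt (letter_b i) b).
Definition epsilon i b := cnt (letter_a' i) b + (cnt (letter_b i) b - cnt (letter_b' i) b).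

(** Hence [phi] counts how often f_i can be applied; this one-step form suits the inductions that
    carry it through c_J. *)
Lemma crystal_f_phi i b :
  if crystal_f i b is Some b2 then phi i b = (phi i b2).+1 else phi i b = 0.
Proof.
have := letter_neq i; rewrite /= !inE => /and4P[/norP[nab /norP[nab' naa']]].
move=> /norP[nbb' nba'] nb'a' _.
have := crystal_fP i b; rewrite /phi; case: ltnP => h1.
  case=> b2 -> h; move: (h (letter_a i)) (h (letter_b i)) (h (letter_b' i)).
  rewrite !eqxx ![_ == letter_a i]eq_sym ![_ == letter_b i]eq_sym
    ![letter_a' i == _]eq_sym.
  by rewrite (negPf nab') (negPf naa') (negPf nbb') (negPf nba') (negPf nb'a'); lia.
case: posnP => h2; first by move=> ->; lia.
case=> b2 -> h; move: (h (letter_a i)) (h (letter_b i)) (h (letter_b' i)).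
rewrite !eqxx ![_ == letter_a i]eq_sym.
by rewrite (negPf nab) (negPf nab') (negPf nbb'); lia.
Qed.

Lemma crystal_e_epsilon i b :
  if crystal_e i b is Some b2 then epsilon i b = (epsilon i b2).+1 else epsilon i b = 0.
Proof.
have := letter_neq i; rewrite /= !inE => /and4P[/norP[nab /norP[nab' naa']]].
move=> /norP[nbb' nba'] nb'a' _.
have := crystal_eP i b; rewrite /epsilon; case: ltnP => h1.
  case=> b2 -> h; move: (h (letter_a' i)) (h (letter_b i)) (h (letter_b' i)).
  rewrite !eqxx.
  by rewrite (negPf nba') (negPf nbb') (negPf naa') (negPf nab') (negPf nab); lia.
case: posnP => h2; first by move=> ->; lia.
case=> b2 -> h; move: (h (letter_a' i)) (h (letter_b i)) (h (letter_b' i)).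
rewrite !eqxx ![letter_a' i == _]eq_sym ![_ == letter_b i]eq_sym.
by rewrite (negPf nba') (negPf nbb') (negPf nb'a'); lia.
Qed.

Lemma paired_lcol b i :
  paired b (lcol i) = minn (cnt (letter_a i) b) (cnt (letter_a' i) b).
Proof. by []. Qed.

Lemma paired_rcol b i :
  paired b (rcol i) = minn (cnt (letter_b i) b) (cnt (letter_b' i) b).
Proof.
rewrite /paired /letter_b /letter_b'; case: (i =P ord_max) => [->|//].
by rewrite /rcol eqxx minnC.
Qed.

(** The minimum of the counts of b and b' is kept: a becomes b only if b is at least as frequent as
    b', and b' becomes a' only if b' is strictly more frequent than b. *)
Lemma crystal_f_paired i b b2 j :
  crystal_f i b = Some b2 -> j != lcol i -> paired b2 j = paired b j.
Proof.
move=> fb jc.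
have := letter_neq i; rewrite /= !inE => /and4P[/norP[nab /norP[nab' naa']]].
move=> /norP[nbb' nba'] nb'a' _.
case: (eqVneq j (rcol i)) => [->|jc1].
  have := crystal_fP i b; rewrite !paired_rcol fb; case: ltnP => h1.
    case=> _ [<-] h; move: (h (letter_b i)) (h (letter_b' i)).
    rewrite eqxx ![_ == letter_b i]eq_sym ![letter_a' i == _]eq_sym.
    by rewrite (negPf nbb') (negPf nba') (negPf nb'a'); lia.
  case: posnP => // h2.
  case=> _ [<-] h; move: (h (letter_b i)) (h (letter_b' i)).
  by rewrite eqxx (negPf nab) (negPf nab') (negPf nbb'); lia.
(* Any other column contains none of the four letters. *)
have xE x : x \in [:: letter_a i; letter_b i; letter_b' i; letter_a' i] ->
    (x == inl j = false) * (x == inr j = false).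
  rewrite !inE => /or4P[] /eqP ->; rewrite /letter_a /letter_a' /letter_b /letter_b'.
  - by rewrite eq_inl eq_inlr -!eq_ord ![_ == j]eq_sym (negPf jc).
  - case: (i =P ord_max) jc1 => [->|_];
      rewrite ?eq_inl ?eq_inr ?eq_inlr ?eq_inrl -!eq_ord.
      by rewrite /rcol eqxx => jc1; rewrite ![_ == j]eq_sym (negPf jc1).
    by move=> jc1; rewrite ![_ == j]eq_sym (negPf jc1).
  - case: (i =P ord_max) jc1 => [->|_];
      rewrite ?eq_inl ?eq_inr ?eq_inlr ?eq_inrl -!eq_ord.
      by rewrite /rcol eqxx => jc1; rewrite ![_ == j]eq_sym (negPf jc1).
    by move=> jc1; rewrite ![_ == j]eq_sym (negPf jc1).
  - by rewrite eq_inr eq_inrl -!eq_ord ![_ == j]eq_sym (negPf jc).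
have := crystal_fP i b; rewrite /paired fb.
by do 2?[case: ifP => // _]; case=> _ [<-] h; move: (h (inl j)) (h (inr j));
  rewrite !xE ?inE ?eqxx ?orbT // !addn0 => -> ->.
Qed.

Local Open Scope ring_scope.

Lemma letter_wtE x j : letter_wt x 0 j = (x == inl j)%:R - (x == inr j)%:R.
Proof.
case: x => k; rewrite /= ?eq_inl ?eq_inr ?eq_inlr ?eq_inrl !mxE.
  by rewrite eq_sym subr0.
by rewrite eq_sym sub0r.
Qed.

Lemma wtE b j : wt b 0 j = (cnt (inl j) b)%:Z - (cnt (inr j) b)%:Z.
Proof.
rewrite /wt /cnt; elim: (val (val b)) => [|x s IHs]; first by rewrite big_nil mxE.
rewrite big_cons mxE IHs letter_wtE /=.
by case: (x == inl j); case: (x == inr j); lia.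
Qed.

Lemma simple_root_a i : simple_root i = letter_wt (letter_a i) - letter_wt (letter_b i).
Proof.
apply/rowP => j; rewrite !mxE !letter_wtE /simple_root.
have := ltn_ord j; case: (ltnP i.+1 m) => im; rewrite !mxE; letter_cases m' i; try lia.
Qed.

Lemma simple_root_b i : simple_root i = letter_wt (letter_b' i) - letter_wt (letter_a' i).
Proof.
rewrite simple_root_a; apply/rowP => j; rewrite !mxE !letter_wtE.
by letter_cases m' i; lia.
Qed.

Lemma wt_move b b2 x y :
  (forall z, (cnt z b2 + (x == z) = cnt z b + (y == z))%N) ->
  wt b2 = wt b - (letter_wt x - letter_wt y).
Proof.
move=> h; apply/rowP => j; rewrite !mxE !wtE !letter_wtE.
have := h (inl j); have := h (inr j).
by do 4?case: (_ == _); lia.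
Qed.

Lemma wt_crystal_f i b b2 : crystal_f i b = Some b2 -> wt b2 = wt b - simple_root i.
Proof.
move=> fb; have := crystal_fP i b; rewrite fb; do 2?[case: ifP => // _].
  by case=> _ [<-] /wt_move ->; rewrite simple_root_b.
by case=> _ [<-] /wt_move ->; rewrite simple_root_a.
Qed.

Lemma wt_crystal_e i b b2 : crystal_e i b = Some b2 -> wt b2 = wt b + simple_root i.
Proof.
move=> fb; have := crystal_eP i b; rewrite fb; do 2?[case: ifP => // _].
  by case=> _ [<-] /wt_move ->; rewrite simple_root_a !opprB.
by case=> _ [<-] /wt_move ->; rewrite simple_root_b !opprB.
Qed.

(** The two truncated differences of b and b' add up to an absolute value, and the counts of a and
    a' satisfy [p + q = 2 min(p, q) + |p - q|]. *)
Lemma phi_epsilon i b : (phi i b + epsilon i b =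
  (paired b (lcol i)).*2 + `|wt b 0%R (lcol i)| + `|wt b 0%R (rcol i)|)%N.
Proof.
have -> : `|wt b 0%R (rcol i)|%N =
    `|(cnt (letter_b i) b)%:Z - (cnt (letter_b' i) b)%:Z|%N.
  rewrite wtE /letter_b /letter_b'; case: (i =P ord_max) => [->|//].
  by rewrite /rcol eqxx; lia.
rewrite paired_lcol wtE -/(letter_a i) -/(letter_a' i) /phi /epsilon; lia.
Qed.

(** Minimum and difference determine two counts, and a sorted row is determined by its counts
    because the order is antisymmetric. *)
Lemma row_eqP b b2 : wt b = wt b2 -> paired b =1 paired b2 -> b = b2.
Proof.
move=> ewt eM; apply/val_inj/val_inj => /=.
apply: (sorted_eq (@letter_le_trans m') (@letter_le_anti m') (valP b) (valP b2)).
apply/allP => x _; apply/eqP; rewrite -!/(cnt _ _).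
case: x => j; have := congr1 (fun v : 'rV_m => v 0 j) ewt; have := eM j;
  rewrite !wtE /paired; move: (cnt (inl j) b) (cnt (inr j) b);
  move: (cnt (inl j) b2) (cnt (inr j) b2) => ? ? ? ?; lia.
Qed.

End Coordinates.

(** * Weyl group *)

Section Weyl.
Variable m' : nat.
Local Notation m := m'.+3.
Implicit Types (i j k l : 'I_m) (v : weight m).
Local Open Scope ring_scope.

Definition root_sign i : int := if i == ord_max then -1 else 1.

Lemma simple_rootE i :
  simple_root i = eps m (lcol i) - root_sign i *: eps m (rcol i).
Proof.
rewrite /simple_root /root_sign eq_ord !lettersE /=; have := ltn_ord i.
case: (ltnP i.+1 m) => h1; case: (eqVneq (i : nat) m'.+2) => h2 h3.
- by rewrite h2 ltnn in h1.
- by rewrite scale1r.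
- by rewrite scaleN1r opprK h2.
- by lia.
Qed.

Lemma lcol_neq_rcol i : lcol i != rcol i.
Proof. by letter_cases m' i; lia. Qed.

Lemma dotB v w1 w2 : dot v (w1 - w2) = dot v w1 - dot v w2.
Proof. by rewrite /dot -sumrB; apply: eq_bigr => j _; rewrite !mxE mulrBr. Qed.

Lemma dotZ v a w : dot v (a *: w) = a * dot v w.
Proof. by rewrite /dot mulr_sumr; apply: eq_bigr => j _; rewrite !mxE mulrCA. Qed.

Lemma dot_eps v j : dot v (eps m j) = v 0 j.
Proof.
rewrite /dot (bigD1 j) //= mxE eqxx mulr1 big1 ?addr0 // => k /negPf kj.
by rewrite mxE -eq_ord kj mulr0.
Qed.

Lemma reflectionE i v j : reflection i v 0 j =
  if j == lcol i then root_sign i * v 0 (rcol i)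
  else if j == rcol i then root_sign i * v 0 (lcol i) else v 0 j.
Proof.
have s2 : root_sign i * root_sign i = 1 by rewrite /root_sign; case: ifP.
have := lcol_neq_rcol i.
rewrite /reflection simple_rootE dotB dotZ !dot_eps !mxE -!eq_ord.
case: (eqVneq j (lcol i)) => [->|_] lr; first by rewrite (negPf lr) /=; ring.
case: eqP => [->|_] /=; last by ring.
move: s2; rewrite /root_sign; case: ifP => _ _; ring.
Qed.

Lemma reflection_perm i v j : i != ord_max ->
  reflection i v 0 j = v 0 (tperm (lcol i) (rcol i) j).
Proof.
rewrite reflectionE /root_sign => /negPf->; rewrite !mul1r.
case: tpermP => [->|->|/eqP/negPf-> /eqP/negPf->] //; rewrite ?eqxx //.
by rewrite eq_sym (negPf (lcol_neq_rcol i)).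
Qed.

Lemma absz_reflection i v j :
  `|reflection i v 0%R j|%N = `|v 0%R (tperm (lcol i) (rcol i) j)|%N.
Proof.
have sgn (z : int) : `|(root_sign i * z)%R|%N = `|z|%N.
  by rewrite /root_sign; case: ifP => _; lia.
rewrite reflectionE; case: tpermP => [->|->|/eqP/negPf-> /eqP/negPf->] //.
  by rewrite eqxx sgn.
by rewrite eq_sym (negPf (lcol_neq_rcol i)) eqxx sgn.
Qed.

Lemma reflectionB i v w : reflection i (v - w) = reflection i v - reflection i w.
Proof.
have subE (x y : weight m) k : (x - y) 0 k = x 0 k - y 0 k by rewrite !mxE.
apply/rowP => j; rewrite [RHS]subE !reflectionE !subE.
by do 2?case: ifP => _; rewrite ?mulrBr.
Qed.

Lemma reflectionK i : involutive (@reflection m i).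
Proof.
have s2 : root_sign i * root_sign i = 1 by rewrite /root_sign; case: ifP.
move=> v; apply/rowP => j; rewrite !reflectionE !eqxx [rcol i == _]eq_sym.
rewrite (negPf (lcol_neq_rcol i)) !mulrA !s2 !mul1r.
by case: eqP => [->|_] //; case: eqP => [->|].
Qed.

Lemma word_actB s v w : @word_act m s (v - w) = word_act s v - word_act s w.
Proof. by elim: s => //= i s ->; rewrite reflectionB. Qed.

Lemma word_act_cat s t v : @word_act m (s ++ t) v = word_act s (word_act t v).
Proof. by rewrite /word_act foldr_cat. Qed.

Lemma word_act_revK s v : @word_act m (rev s) (word_act s v) = v.
Proof.
elim: s v => //= i s IHs v.
by rewrite rev_cons -cats1 word_act_cat /= reflectionK.
Qed.

(** Signs enter a word only through the last node. *)
Lemma word_act_perm s : all [pred i | i != ord_max] s ->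
  exists p : {perm 'I_m}, forall v j, word_act s v 0 j = v 0 (p j).
Proof.
elim: s => [|i s IHs] /=; first by exists 1%g => v j; rewrite perm1.
case/andP=> im /IHs[p pE]; exists (tperm (lcol i) (rcol i) * p)%g => v j.
by rewrite reflection_perm // pE permM.
Qed.

(** Signs can be discarded here because [phi_epsilon] sees weights only through absolute values. *)
Lemma absz_word_act s :
  exists p : {perm 'I_m}, forall v j, `|word_act s v 0%R j|%N = `|v 0%R (p j)|%N.
Proof.
elim: s => [|i s [p pE]] /=; first by exists 1%g => v j; rewrite perm1.
exists (tperm (lcol i) (rcol i) * p)%g => v j.
by rewrite absz_reflection // pE permM.
Qed.

Lemma absz_simple_root i l :
  `|simple_root i 0%R l|%N = ((l == lcol i) || (l == rcol i))%N.
Proof.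
have := lcol_neq_rcol i; rewrite simple_rootE !mxE -!eq_ord /root_sign.
case: (eqVneq l (lcol i)) => [->|_]; first by move/negPf->; case: ifP.
by move=> _; case: eqP => _; case: eqP.
Qed.

Lemma simple_root_neq_opp i : simple_root i != - simple_root i.
Proof.
apply/eqP => e; have := congr1 (fun v : weight m => v 0 (lcol i)) e.
by rewrite simple_rootE !mxE -!eq_ord eqxx (negPf (lcol_neq_rcol i)) mulr0.
Qed.

(** Whether [xget] returns a longest word or its default, the empty word, the result is a word in
    [J]. *)
Lemma w0_word (J : {set 'I_m}) : exists2 s, all [in J] s & @w0 m J = word_act s.
Proof.
exists (classical_sets.xget [::] (longest J)) => //.
have := classical_sets.xgetP [::] (longest J).
by case=> [s _ [[]]|].
Qed.

Lemma theta_in (J : {set 'I_m}) j : j \in J -> theta J j \in J.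
Proof. by rewrite /theta; case: pickP => [k /andP[]|]. Qed.

End Weyl.

(** * The maps c_J in coordinates *)

Section CactusMap.
Variables m' n : nat.
Local Notation m := m'.+3.
Variables (J : {set 'I_m}) (c : row_type m n -> row_type m n).
Hypotheses (n_gt0 : 0 < n) (cJ : cactus_map J c).
Implicit Types (i j k l : 'I_m) (b : row_type m n).

(** As [c] intertwines f_j with e_theta(j), the two strings shorten together and end together. *)
Lemma phi_cactus_map j b : j \in J -> phi j (c b) = epsilon (theta J j) b.
Proof.
case: cJ => _ _ _ cf jJ.
have [p] := ubnP (epsilon (theta J j) b); elim: p b => // p IHp b lep.
have := crystal_f_phi j (c b); have := crystal_e_epsilon (theta J j) b.
rewrite (cf _ _ jJ); case: (crystal_e _ b) => [b2|] /=; last by move=> -> ->.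
by move=> eb ->; rewrite eb IHp //; lia.
Qed.

Lemma epsilon_cactus_map j b : j \in J -> epsilon j (c b) = phi (theta J j) b.
Proof.
case: cJ => _ _ ce _ jJ.
have [p] := ubnP (phi (theta J j) b); elim: p b => // p IHp b lep.
have := crystal_e_epsilon j (c b); have := crystal_f_phi (theta J j) b.
rewrite (ce _ _ jJ); case: (crystal_f _ b) => [b2|] /=; last by move=> -> ->.
by move=> eb ->; rewrite eb IHp //; lia.
Qed.

Lemma exists_row (t : n.-tuple (letter m)) : sorted (@letter_le m) t ->
  exists b : row_type m n, val b = t.
Proof. by move=> h; exists (exist _ t h). Qed.

Lemma phi_gt0 i : exists b : row_type m n, 0 < phi i b.
Proof.
(* The witness is the constant row of letters a, nonempty by [n_gt0]. *)
have srt : sorted (@letter_le m) (nseq_tuple n (letter_a i)).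
  apply/sorted_tnth => k l _; rewrite !tnth_nseq /=.
  by rewrite leqnn.
have [b bE] := exists_row srt; exists b.
rewrite /phi /cnt bE /= count_nseq /= eqxx; lia.
Qed.

(* Read off from the weights of e_j (c b) = c (f_theta(j) b), which avoids any
   length argument in W_J. *)
Lemma w0_simple_root j : j \in J ->
  w0 J (simple_root (theta J j)) = (- simple_root j)%R.
Proof.
case: cJ => _ cw ce _ jJ; have [b pb] := phi_gt0 (theta J j).
have := crystal_f_phi (theta J j) b.
case fb: (crystal_f _ b) => [b2|]; last by lia.
move=> _; have := ce j b jJ; rewrite fb /= => /wt_crystal_e.
have [s _ w0E] := w0_word J.
rewrite !cw (wt_crystal_f fb) w0E word_actB => e.
by apply: oppr_inj; rewrite opprK; apply: (addrI (word_act s (wt b))).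
Qed.

(** The sum of [phi] and [epsilon] at [j] for [c b] equals the one at [theta J j] for [b]. The
    absolute weights in [phi_epsilon] also agree up to order, so the doubled numbers of pairs
    agree. *)
Lemma paired_theta j b : j \in J ->
  paired (c b) (lcol j) = paired b (lcol (theta J j)).
Proof.
move=> jJ; set k := theta J j.
have e1 := phi_epsilon j (c b); have e2 := phi_epsilon k b.
rewrite phi_cactus_map // epsilon_cactus_map // -/k in e1.
have [s _ w0E] := w0_word J; have [p pE] := absz_word_act s.
have cw : wt (c b) = word_act s (wt b) by case: cJ => _ -> _ _; rewrite w0E.
(* Comparing the supports of both sides of [w0_simple_root] shows that [p] carries the two columns
   of [j] to those of [k]. *)
have supp l : ((p l == lcol k) || (p l == rcol k)) = ((l == lcol j) || (l == rcol j)).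
  have := congr1 (fun v : weight m => `|v 0%R l|%N) (w0_simple_root jJ).
  rewrite w0E pE -/k mxE abszN !absz_simple_root.
  by do 2![case: (_ || _)].
have h1 : (p (lcol j) == lcol k) || (p (lcol j) == rcol k) by rewrite supp eqxx.
have h2 : (p (rcol j) == lcol k) || (p (rcol j) == rcol k) by rewrite supp eqxx orbT.
have p12 : p (lcol j) != p (rcol j) by rewrite (inj_eq perm_inj) lcol_neq_rcol.
move: e1; rewrite cw !pE.
by case/orP: h1 p12 => /eqP->; case/orP: h2 => /eqP ->; rewrite ?eqxx // => _; lia.
Qed.

(** The rows [b] and [c b] are joined by edges labelled in [J], and by [crystal_f_paired] an edge
    labelled [j] can change only the column [lcol j]. *)
Lemma paired_outside b l : {in J, forall j, l != lcol j} ->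
  paired (c b) l = paired b l.
Proof.
move=> lJ; case: cJ => /(_ b) con _ _ _.
have cl : closed [rel x y | [exists j in J, (crystal_f j x == Some y) ||
    (crystal_f j y == Some x)]] [pred x : row_type m n | paired x l == paired b l].
  move=> x y /= /exists_inP[j jJ /orP[]/eqP /crystal_f_paired h];
    by rewrite !inE h ?lJ.
by have := closed_connect cl con; rewrite !inE eqxx => /esym/eqP.
Qed.

Lemma lcol_not_last j : lcol j != ord_max.
Proof.
rewrite eq_ord val_lcol /=; have := ltn_ord j.
by case: (eqVneq (j : nat) m'.+2); lia.
Qed.

Lemma lcol_id j : j != ord_max -> lcol j = j.
Proof. by rewrite /lcol => /negPf->. Qed.

(** The two spin nodes share their left column, so [pick] may have a choice; [paired_theta]
    justifies either one. *)
Definition column_map l : 'I_m :=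
  if [pick j in J | l == lcol j] is Some j then lcol (theta J j) else l.

Lemma paired_column_map b l : paired (c b) l = paired b (column_map l).
Proof.
rewrite /column_map; case: pickP => [j /andP[jJ /eqP->]|h]; first exact: paired_theta.
by apply: paired_outside => j jJ; apply/negP => lj; have := h j; rewrite jJ lj.
Qed.

Lemma column_map_last : column_map ord_max = ord_max.
Proof.
rewrite /column_map; case: pickP => // j /andP[_ /eqP h].
by have := lcol_not_last j; rewrite -h eqxx.
Qed.

Lemma exists_paired l : 1 < n -> l != ord_max ->
  exists b : row_type m n, paired b =1 (fun k => k == l : nat).
Proof.
move=> + ll; case: n => [|[|p]] // _.
(* The row consists of letters l followed by a single l-bar. It is sorted because a letter other
   than the last lies below its bar. *)
pose t := [tuple of inl l :: rcons (nseq p (inl l)) (inr l)] : p.+2.-tuple (letter m).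
have srt : sorted (@letter_le m) t.
  have lx : letter_le (inl l : letter m) (inl l) by rewrite /= leqnn.
  have ly : letter_le (inl l : letter m) (inr l).
    by move: ll; rewrite eq_ord /=; lia.
  rewrite [sorted _ _]/(path _ _ _); move: (@letter_le m) lx ly => R lx ly.
  by elim: p {t} => /= [|p ->]; rewrite ?lx ?ly.
exists (exist _ t srt) => k; rewrite /paired /cnt /= -cats1 !count_cat !count_nseq /=.
rewrite eq_inl eq_inr [k == l]eq_sym eq_ord.
by case: (_ == _); lia.
Qed.

Hypothesis cK : involutive c.

(** Rows with a single pair separate the columns, so [cK] forces [column_map] to be an involution as
    soon as a row has room for a pair. *)
Lemma column_map_perm : exists2 p : {perm 'I_m}, p ord_max = ord_max &
  forall b l, paired (c b) l = paired b (p l).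
Proof.
case: (ltnP 1 n) => [n_gt1|n_le1].
  have mapK : involutive column_map.
    move=> l; case: (eqVneq l ord_max) => [->|ll]; first by rewrite !column_map_last.
    have [b bE] := exists_paired n_gt1 ll.
    have := paired_column_map (c b) l; rewrite cK paired_column_map !bE eqxx.
    by case: eqP.
  exists (perm (inv_inj mapK)); first by rewrite permE column_map_last.
  by move=> b l; rewrite permE paired_column_map.
(* With at most one letter there are no pairs, and the identity serves. *)
exists 1%g => [|b l]; first by rewrite perm1.
suff p0 b' l' : paired b' l' = 0 by rewrite !p0.
have le_size (s : seq (letter m)) : count_mem (inl l') s + count_mem (inr l') s <= size s.
  by elim: s => //= x s; case: x => x; rewrite ?eq_inlr ?eq_inrl; case: (_ == _); lia.
have := le_size (val (val b')); rewrite size_tuple /paired /cnt.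
by move: (count_mem (inl l') _) (count_mem (inr l') _) => p q; lia.
Qed.

End CactusMap.

(** * Generation by small subdiagrams *)

(** Induction on the number of moved points: if [p y = x] with [x] moved, then [tperm x y * p] fixes
    [x] and moves no new point. *)
Lemma perm_ind_tperm (T : finType) (A : {pred T}) (P : {perm T} -> Prop) :
  P 1%g ->
  (forall x y p, x \in A -> y \in A -> x != y -> P p -> P (tperm x y * p)%g) ->
  forall p : {perm T}, (forall x, p x != x -> x \in A) -> P p.
Proof.
move=> P1 PM p; have [k] := ubnP #|[pred x | p x != x]|.
elim: k p => // k IHk p lek pA.
case: (pickP [pred x | p x != x]) => [x /= px|fix_p]; last first.
  by have -> : p = 1%g; [apply/permP => x; have /negbFE/eqP := fix_p x; rewrite perm1|].
pose y := (p^-1)%g x; have py : p y = x by rewrite permKV.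
have xy : x != y by apply: contra px => /eqP e; rewrite {1}e py.
pose q := (tperm x y * p)%g.
have qx : q x = x by rewrite permM tpermL.
have supp z : q z != z -> (z != x) && (p z != z).
  case: (eqVneq z x) => [->|zx] /=; first by rewrite qx eqxx.
  case: (eqVneq z y) => [->|zy]; first by rewrite py.
  by rewrite permM tpermD // eq_sym.
have -> : p = (tperm x y * q)%g by rewrite mulgA tperm2 mul1g.
apply: (PM _ _ _ (pA _ px) (pA _ _) xy); first by rewrite py.
apply: IHk => [|z /supp/andP[_]]; last exact: pA.
apply: leq_trans (proper_card _) lek; apply/properP; split.
  by apply/subsetP => z; rewrite !inE => /supp/andP[].
by exists x; rewrite !inE ?qx ?eqxx.
Qed.

Section Subdiagrams.
Variable m : nat.

Lemma connected_sub1 (i : 'I_m) : connected_sub [set i].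
Proof.
apply/andP; split; first by apply/set0Pn; exists i; rewrite set11.
by apply/forall_inP => x /set1P->; apply/forall_inP => y /set1P->; apply: connect0.
Qed.

Lemma connected_sub2 (i j : 'I_m) : adjacent i j -> connected_sub [set i; j].
Proof.
move=> ij; have ji : adjacent j i by rewrite /adjacent orbC.
apply/andP; split; first by apply/set0Pn; exists i; rewrite set21.
apply/forall_inP => x /set2P[]->; apply/forall_inP => y /set2P[]->; rewrite ?connect0 //.
  by apply: connect1; rewrite /= set21 set22.
by apply: connect1; rewrite /= set21 set22.
Qed.

End Subdiagrams.

(** * Weyl elements and column permutations realized by small generators *)

Section Image.
Variables m' n : nat.
Local Notation m := m'.+3.
Variable act : cactus m -> row_type m n -> row_type m n.
Hypotheses (n_gt0 : 0 < n) (hact : cactus_action act).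
Implicit Types (i j k l : 'I_m) (b : row_type m n) (J : subdiagram m).

Local Notation G := <<small_generators act>>%g.

Lemma act_genK J : involutive (act (cactus_gen J)).
Proof.
case: hact => act1 actM _ b; rewrite -actM -[RHS]act1; congr (act _ _).
by rewrite [LHS]cactus_mulE; apply/cactus_piP; apply: Cactus_invol.
Qed.

Definition gen_perm J : {perm row_type m n} := perm (inv_inj (act_genK J)).

Lemma gen_permE J b : gen_perm J b = act (cactus_gen J) b.
Proof. by rewrite permE. Qed.

Lemma gen_perm_small J : (#|val J| == 1) || (#|val J| == 2) -> gen_perm J \in G.
Proof.
move=> cardJ; apply: mem_gen; rewrite inE; apply/existsP; exists J.
by rewrite cardJ; apply/forallP => b; rewrite gen_permE.
Qed.

Lemma gen_map J : cactus_map (val J) (act (cactus_gen J)).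
Proof. by case: hact. Qed.

(** By [row_eqP] the pair [(w, p)] determines [g], so membership in the group can be tested on
    coordinates. *)
Definition realizable (w : weight m -> weight m) (p : {perm 'I_m}) : Prop :=
  exists2 g : {perm row_type m n}, g \in G &
    forall b, wt (g b) = w (wt b) /\ forall l, paired (g b) l = paired b (p l).

Lemma realizable_comp w w' p p' : realizable w p -> realizable w' p' ->
  realizable (w \o w') (p * p').
Proof.
(* Products of permutations apply the left factor first, so [g' * g] acts on weights by [w \o w'];
   columns are precomposed, which gives [p * p']. *)
case=> g gG gE [g' g'G g'E]; exists (g' * g)%g; first exact: groupM.
move=> b; rewrite permM; have [-> pg] := gE (g' b); have [-> pg'] := g'E b.
by split=> // l; rewrite pg pg' permM.
Qed.

Lemma eq_realizable w w' p : w =1 w' -> realizable w p -> realizable w' p.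
Proof. by move=> ew [g gG gE]; exists g => // b; rewrite -ew. Qed.

(** Words in a single node act as the identity or as its reflection, and only the latter negates the
    root. As [theta] fixes the node, no column moves. *)
Lemma realizable_reflection i : realizable (@reflection m i) 1.
Proof.
pose J : subdiagram m := exist (fun K => is_true (connected_sub K)) _ (connected_sub1 i).
have JE : val J = [set i] by [].
exists (gen_perm J); first by apply: gen_perm_small; rewrite JE cards1.
have th : theta (val J) i = i by apply/set1P; rewrite -JE theta_in // set11.
have w0i : w0 (val J) (simple_root i) = (- simple_root i)%R.
  by rewrite -{1}th (w0_simple_root n_gt0 (gen_map J)) // set11.
have w0E : w0 (val J) =1 @reflection m i.
  have [s sJ e] := w0_word (val J); move: w0i; rewrite e JE in sJ *.
  have : (word_act s =1 id) \/ (word_act s =1 @reflection m i).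
    elim: s sJ {e} => [|k s IHs] /=; first by left.
    case/andP => /set1P -> /IHs[] ws; [right|left] => v;
      rewrite [LHS]/= -/(word_act s v) ws //.
    by rewrite reflectionK.
  by case=> // -> /eqP; rewrite (negPf (simple_root_neq_opp i)).
move=> b; rewrite gen_permE; split; first by rewrite -w0E; case: (gen_map J).
move=> l; rewrite perm1 (paired_column_map n_gt0 (gen_map J)); congr paired.
rewrite /column_map; case: pickP => // j /andP[/set1P-> /eqP->]; by rewrite th.
Qed.

Lemma realizable_word s : realizable (@word_act m s) 1.
Proof.
elim: s => [|i s IHs]; first by exists 1%g => // b; split=> [|l]; rewrite perm1 ?perm1.
by rewrite -[1%g]mulg1; apply: realizable_comp IHs; apply: realizable_reflection.
Qed.

(** Reflections fix all columns, so composing c_J with the inverse word removes its action on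
    weights and leaves [p]. *)
Lemma realizable_w0 J (p : {perm 'I_m}) :
  (forall b l, paired (act (cactus_gen J) b) l = paired b (p l)) ->
  gen_perm J \in G -> realizable id p.
Proof.
move=> pE JG; have [s _ w0E] := w0_word (val J).
rewrite -[p]mul1g; apply: (@eq_realizable (word_act (rev s) \o word_act s)).
  exact: word_act_revK.
apply: realizable_comp; first exact: realizable_word.
exists (gen_perm J) => // b; rewrite gen_permE; split=> //.
by rewrite -w0E; case: (gen_map J).
Qed.

(** The subdiagram with nodes [i] and [j] has type A_2, and [theta] swaps its nodes; c_J therefore
    swaps their left columns, which are [i] and [j] themselves. *)
Lemma realizable_next i j : j = i.+1 :> nat -> j != ord_max ->
  realizable id (tperm i j).
Proof.
move=> ij jl.
have il : i != ord_max by move: jl; rewrite !eq_ord /=; have := ltn_ord j; lia.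
have adj : adjacent i j.
  by rewrite /adjacent /edge ij; move: jl; rewrite eq_ord /=; have := ltn_ord j; lia.
pose J : subdiagram m := exist (fun K => is_true (connected_sub K)) _ (connected_sub2 adj).
have JE : val J = [set i; j] by [].
have nij : i != j by rewrite eq_ord; lia.
have iJ : i \in val J by rewrite JE set21.
have jJ : j \in val J by rewrite JE set22.
have ri : rcol i = j.
  by apply/val_inj; rewrite /= val_rcol; move: il; rewrite eq_ord /= => /negPf->.
have [s sJ w0E] := w0_word (val J).
(* The last node is not in [J], so [w0] permutes coordinates without signs. *)
have [p pE] : exists p : {perm 'I_m}, forall v l, (word_act s v 0 l = v 0 (p l))%R.
  apply: word_act_perm; apply: sub_all sJ => k kJ.
  by have : k \in val J by []; rewrite JE => /set2P[]->.
have wi := w0_simple_root n_gt0 (gen_map J) iJ.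
have wj := w0_simple_root n_gt0 (gen_map J) jJ.
have at_ k v : w0 (val J) v = (- simple_root k)%R ->
    forall l, v 0%R (p l) = (- simple_root k 0%R l)%R.
  by rewrite w0E => e l; rewrite -pE e mxE.
have rootE k l : k != ord_max ->
    simple_root k 0%R l = ((l == k)%:R - (l == rcol k)%:R)%R.
  by move=> kl; rewrite simple_rootE /root_sign (negPf kl) scale1r lcol_id // !mxE -!eq_ord.
have rj : i != rcol j.
  by rewrite eq_ord val_rcol; move: jl; rewrite eq_ord /= => /negPf->; lia.
have aii : simple_root i 0%R i = 1%R by rewrite rootE // ri eqxx (negPf nij).
have aji : simple_root j 0%R i = 0%R by rewrite rootE // (negPf nij) (negPf rj).
have ajj : simple_root j 0%R j = 1%R.
  by rewrite rootE // eqxx -[X in X == rcol j](lcol_id jl) (negPf (lcol_neq_rcol j)).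
(* Equal values would make the two negated simple roots equal, yet their coordinates at [i] are -1
   and 0. *)
have neq_theta : theta (val J) i != theta (val J) j.
  apply/eqP => e; have := at_ _ _ wj i; rewrite -e (at_ _ _ wi) aii aji; lia.
have [ti tj] : theta (val J) i = j /\ theta (val J) j = i.
  have := neq_theta.
  have /set2P[ti|ti] := theta_in iJ; have /set2P[tj|tj] := theta_in jJ;
    rewrite ti tj ?eqxx // => _; exfalso.
  (* If [theta] were the identity on [J], the root of [i] would force [p i = j], where the root of
     [j] takes the value 1 instead of 0. *)
  have := at_ _ _ wi i; rewrite ti aii rootE // ri.
  have := at_ _ _ wj i; rewrite tj aji.
  by case: (p i =P j) => [->|_]; [rewrite ajj; lia | case: (_ == _); lia].
apply: (@realizable_w0 J) => [b l|]; last first.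
  by apply: gen_perm_small; rewrite JE cards2 nij orbT.
rewrite (paired_column_map n_gt0 (gen_map J)); congr paired.
rewrite /column_map; case: pickP => [k /andP[/set2P[]-> /eqP->]|h].
- by rewrite ti !lcol_id // tpermL.
- by rewrite tj !lcol_id // tpermR.
- rewrite tpermD // eq_sym; apply/negP => /eqP e.
    by have := h i; rewrite iJ e lcol_id // eqxx.
  by have := h j; rewrite jJ e lcol_id // eqxx.
Qed.

Lemma realizable_tperm i j : i != ord_max -> j != ord_max -> i != j ->
  realizable id (tperm i j).
Proof.
wlog ij : i j / i < j => [hw|] il jl nij.
  case: (ltngtP i j) => [h|h|/val_inj e]; first exact: hw.
    by rewrite tpermC; apply: hw; rewrite // eq_sym.
  by rewrite e eqxx in nij.
have [d] := ubnP (j - i); elim: d j ij jl nij => // d IHd j ij jl nij lt_d.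
case: (eqVneq (j : nat) i.+1) => [e|ne]; first exact: realizable_next.
have kP : j.-1 < m by have := ltn_ord j; lia.
pose k : 'I_m := Ordinal kP; have kE : k = j.-1 :> nat by [].
have kl : k != ord_max by rewrite eq_ord kE /=; have := ltn_ord j; lia.
have nik : i != k by rewrite eq_ord kE; lia.
have rk : realizable id (tperm i k) by apply: IHd => //; rewrite ?kE; lia.
have rn : realizable id (tperm k j) by apply: realizable_next => //; rewrite kE; lia.
(* Conjugation by the adjacent transposition of [k] and [j] moves [k] to [j] and fixes [i]. *)
have -> : tperm i j = (tperm k j * (tperm i k * tperm k j))%g.
  have := tpermJ i k (tperm k j); rewrite tpermL tpermD // /conjg ?tpermV => [<- //||].
    by rewrite eq_sym.
  by rewrite eq_sym.
by apply: (realizable_comp rn); apply: (realizable_comp rk).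
Qed.

Lemma realizable_perm (p : {perm 'I_m}) : p ord_max = ord_max -> realizable id p.
Proof.
move=> pl; apply: (@perm_ind_tperm _ (predC1 ord_max)).
- exact: (realizable_word [::]).
- by move=> i j q il jl nij; apply: (@realizable_comp id id); apply: realizable_tperm.
- by move=> i; apply: contra => /eqP->; rewrite pl.
Qed.

(** In coordinates c_J is a word of reflections on weights together with a column permutation fixing
    the last column. Such a pair is realizable, and [row_eqP] identifies the two permutations of
    rows. *)
Lemma gen_perm_in J : gen_perm J \in G.
Proof.
have [p pl pE] := column_map_perm n_gt0 (gen_map J) (act_genK J).
have [s _ w0E] := w0_word (val J).
have [g gG gE] := realizable_comp (realizable_word s) (realizable_perm pl).
suff -> : gen_perm J = g by [].
apply/permP => b; have [wg pg] := gE b; apply: row_eqP => [|l].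
  by rewrite wg gen_permE /= -w0E; case: (gen_map J).
by rewrite pg gen_permE pE mul1g.
Qed.

Lemma in_image_gen (p : {perm row_type m n}) : in_image act p <-> p \in G.
Proof.
case: (hact) => act1 actM _; split=> [[g]|].
  rewrite -(cactus_reprK g); elim: (cactus_repr g) p => [|J s IHs] p pE.
    suff -> : p = 1%g by apply: group1.
    by apply/permP => b; rewrite pE perm1 [LHS]act1.
  (* The head of the word acts last, so its permutation is split off on the right of [p]. *)
  rewrite -[p](mulgKV (gen_perm J)) groupM ?gen_perm_in //.
  apply: IHs => b; rewrite permM pE -[J :: s]cat1s -cactus_mulE.
  by rewrite (actM (cactus_gen J)) -gen_permE permK.
(* Conversely, the permutations in the image form a group containing the small generators. *)
pose H := [set q : {perm row_type m n} | `[< in_image act q >]].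
have gH : group_set H.
  apply/group_setP; split=> [|q r].
    by rewrite inE; apply/asboolP; exists 1%g => b; rewrite perm1 act1.
  rewrite !inE => /asboolP[g gE] /asboolP[h hE]; apply/asboolP.
  (* The order is reversed because [act] is a left action. *)
  by exists (h * g)%g => b; rewrite permM gE hE actM.
suff GH : G \subset Group gH by move/(subsetP GH); rewrite inE => /asboolP.
rewrite gen_subG; apply/subsetP => q; rewrite !inE => /existsP[J /andP[_ /forallP qE]].
by apply/asboolP; exists (cactus_gen J) => b; apply/eqP.
Qed.

End Image.

Theorem corollary6p7 (m n : nat) (hm : 3 <= m) (hn : 1 <= n)
    (act : cactus m -> row_type m n -> row_type m n)
    (hact : cactus_action act) (p : {perm (row_type m n)}) :
  in_image act p <-> (p \in <<small_generators act>>)%g.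
Proof.
case: m hm act hact p => [|[|[|m']]] // _ act hact p.
exact: in_image_gen.
Qed.
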